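(* Let $r$ be a positive integer and $m\neq 1$ a square-free rational integer such that $F(x)=x^{2^r}-m$ is irreducible over $\mathbb{Q}$. Let $\alpha$ be a complex root of $F(x)$ and $K=\mathbb{Q}(\alpha)$. Then: (1) if $r=2$ and $m\equiv 1\pmod{16}$, then the pure quartic field $K$ is not monogenic; (2) if $r\ge 3$ and $m\equiv 1\pmod{32}$, then $K$ is not monogenic.
   Context: $K$ is called monogenic if its ring of integers $\mathbb{Z}_K$ equals $\mathbb{Z}[\theta]$ for some $\theta\in\mathbb{Z}_K$. *)

(* Defs.v *)
From HB Require Import structures.
From mathcomp Require Import all_boot all_order all_algebra all_field.
Set Implicit Arguments. Unset Strict Implicit. Unset Printing Implicit Defensive.
Import Order.TTheory GRing.Theory Num.Theory.
Local Open Scope ring_scope.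

Definition in_Qadj (a x : algC) : Prop :=
  exists p : {poly rat}, x = (map_poly (ratr : rat -> algC) p).[a].

Definition in_Zadj (t x : algC) : Prop :=
  exists q : {poly int}, x = (map_poly (intr : int -> algC) q).[t].

Definition in_ring_of_integers (a x : algC) : Prop :=
  in_Qadj a x /\ x \in Aint.

Definition monogenic (a : algC) : Prop :=
  exists theta : algC, in_ring_of_integers a theta /\
    forall x : algC, in_ring_of_integers a x <-> in_Zadj theta x.

(* square-free integer: no square of a prime divides it (excludes 0) *)
Definition squarefree_int (m : int) : Prop :=
  forall p : nat, prime p -> ~~ (p ^ 2 %| `|m|)%N.

(* Main.v *)
Require Import Defs.
From HB Require Import structures.
From mathcomp Require Import all_boot all_order all_algebra all_field.
From mathcomp Require Import zify ring.
Import Order.TTheory GRing.Theory Num.Theory.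
Local Open Scope ring_scope.

(* Suppose that O_K = Z[theta] and let f be the minimal polynomial of theta modulo 2, so that
   O_K / 2 = F_2[x] / (f) with deg f <= n = 2 ^ r. Over Q_2, the polynomial X^n - m is a product of
   factors such as X^s + u, X^(2s) + u^2, X^(4s) + u^4, which are Eisenstein at 2 after X := X + 1.
   Globally this factorization shows up as follows: the elements
   (1 + y)(1 + y^2)...(1 + y^(2^(j-1))) / 2^j, for suitable y = alpha^e or y = - alpha^e, are
   algebraic integers which are nonzero orthogonal idempotents modulo 2, and on the component with
   y = - alpha^e the element alpha - 1 is nilpotent of order exactly e. Each component is a
   factor F of f, these factors are coprime, and the nilpotency order forces deg F >= e, and even
   deg F >= 2 e when F has no root in F_2. As the sum of these lower bounds leaves no room in
   deg f <= n for a doubling, three coprime factors have roots in F_2, which has only two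
   elements. *)

(** * Degrees of the components that idempotents cut out of a polynomial *)

Lemma dvdp_exp_size (K : fieldType) (F a : {poly K}) (c e : nat) :
  F != 0 -> F %| a ^+ e.+1 -> ~~ (F %| a ^+ e) ->
  (forall d, d %| F -> size d != 1 -> (c < size d)%N) ->
  (c * e.+1 < size F)%N.
Proof.
move=> F0 Fae Fna cF.
(* The degrees of gcd(F, a ^ i) increase strictly, as two equal consecutive ones would make the
   sequence stationary; the successive quotients divide F. *)
have szg i : (i <= e.+1)%N -> (c * i < size (gcdp F (a ^+ i)))%N.
  elim: i => [|i IH] ie; first by rewrite muln0 size_poly_gt0 gcdp_eq0 negb_and F0.
  have {IH} := IH (ltnW ie).
  set G := gcdp F (a ^+ i); set G' := gcdp F (a ^+ i.+1).
  have G'0 : G' != 0 by rewrite gcdp_eq0 negb_and F0.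
  have GG' : G %| G'.
    by rewrite dvdp_gcd dvdp_gcdl exprSr dvdp_mulr ?dvdp_gcdr.
  have dG' : G' = (G' %/ G) * G by rewrite divpK.
  have q0 : G' %/ G != 0 by apply: contraNneq G'0 => q0; rewrite dG' q0 mul0r.
  have G0 : G != 0 by rewrite gcdp_eq0 negb_and F0.
  have qF : G' %/ G %| F.
    by apply: dvdp_trans (dvdp_gcdl F (a ^+ i.+1)); rewrite -/G' {2}dG' dvdp_mulr.
  suff /(cF _ qF) cq : size (G' %/ G) != 1.
    move=> ciG; rewrite dG' size_mul // mulnS.
    by move: cq ciG; set u := size _; set v := size _; lia.
  apply/negP => /eqP/eqP; rewrite size_poly_eq1 => q1.
  have G'G : G' %| G by rewrite {1}dG' (eqp_dvdl _ (eqp_mulr G q1)) mul1r.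
  suff aF k : gcdp F (a ^+ (i + k)%N) %| G.
    case/negP: Fna; apply: (@dvdp_trans _ (a ^+ i)).
      apply: dvdp_trans (dvdp_gcdr F (a ^+ i)).
      apply: dvdp_trans (aF (e.+1 - i)%N).
      by rewrite subnKC ?(ltnW ie) // dvdp_gcd dvdpp.
    by rewrite dvdp_exp2l // -ltnS.
  elim: k => [|k IH]; first by rewrite addn0.
  apply: dvdp_trans IH; rewrite dvdp_gcd dvdp_gcdl /=.
  have /dvdp_trans -> // : gcdp F (a ^+ (i + k.+1)%N) %| a ^+ k * G'.
    rewrite /G' (eqp_dvdr _ (mulp_gcdr _ _ _)) dvdp_gcd dvdp_mull ?dvdp_gcdl //=.
    by rewrite -exprD addnS addnC addnS addnC dvdp_gcdr.
  apply: (@dvdp_trans _ (a ^+ k * G)); first by rewrite dvdp_mul.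
  by rewrite addnC exprD dvdp_mul // dvdp_gcdr.
by apply: leq_trans (dvdp_leq F0 (dvdp_gcdl F (a ^+ e.+1))); apply: szg.
Qed.

(** As [F] divides [1 - E], it is coprime to [E], which can be cancelled. Conversely, [E * F] is up
    to a unit the gcd of [E * f] and [E * (1 - E)], hence a multiple of [f], so that [F %| a ^+ e]
    would imply [f %| E * a ^+ e]. *)
Lemma gcdp_idem_exp (K : fieldType) (f E a : {poly K}) (e : nat) :
  f %| E * (1 - E) -> f %| E * a ^+ e.+1 -> ~~ (f %| E * a ^+ e) ->
  let F := gcdp f (1 - E) in F %| a ^+ e.+1 /\ ~~ (F %| a ^+ e).
Proof.
move=> fE fEa fEna F.
have FE : coprimep F E.
  apply/coprimepP => d dF dE.
  rewrite -size_poly_eq1 -dvdp1 -[1](subrK E) dvdp_add //.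
  exact: dvdp_trans dF (dvdp_gcdr _ _).
split.
  by rewrite -(Gauss_dvdpr _ FE) (dvdp_trans _ fEa) ?dvdp_gcdl.
apply: contra fEna => Fa.
apply: (@dvdp_trans _ (E * F)); last by rewrite dvdp_mul.
by rewrite /F (eqp_dvdr _ (mulp_gcdr _ _ _)) dvdp_gcd fE dvdp_mull.
Qed.

(** Modulo a common divisor of the two gcds, [E] and [E'] are both 1 while their product is 0. *)
Lemma coprimep_idem (K : fieldType) (f E E' : {poly K}) :
  f %| E * E' -> coprimep (gcdp f (1 - E)) (gcdp f (1 - E')).
Proof.
move=> fEE; apply/coprimepP => d; rewrite !dvdp_gcd => /andP[df dE] /andP[_ dE'].
rewrite -size_poly_eq1 -dvdp1 (_ : 1 = (1 - E) + E * (1 - E') + E * E'); last by ring.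
by apply: dvdp_add (dvdp_trans df fEE); apply: dvdp_add dE (dvdp_mull _ dE').
Qed.

(** This is [dvdp_exp_size] with [c = 1], and with [c = 2] when [F] has no root, since a divisor of
    degree 1 would provide one. *)
Lemma idem_component_size (f E a : {poly 'F_2}) (e : nat) :
  f != 0 -> f %| E * (1 - E) -> f %| E * a ^+ e.+1 -> ~~ (f %| E * a ^+ e) ->
  let F := gcdp f (1 - E) in
  (e.+1 < size F)%N /\ ((2 * e.+1 < size F)%N \/ exists x, root F x).
Proof.
move=> f0 fE fEa fEna F.
have [Fa Fna] := gcdp_idem_exp _ _ _ _ _ fE fEa fEna.
have F0 : F != 0 by rewrite gcdp_eq0 negb_and f0.
have dF0 d : d %| F -> (0 < size d)%N.
  by move=> dF; rewrite size_poly_gt0; apply: contraNneq F0 => d0; rewrite d0 dvd0p in dF.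
split.
  rewrite -[e.+1]mul1n; apply: dvdp_exp_size F0 Fa Fna _ => d /dF0.
  by case: (size d) => [|[]].
have [/existsP[x xF]|/negP nF] := boolP [exists x, root F x]; first by right; exists x.
left; apply: dvdp_exp_size F0 Fa Fna _ => d dF d1.
rewrite ltnNge; apply/negP => d2; have /poly2_root[x dx] : size d = 2.
  by move: (dF0 _ dF) d1 d2; set u := size d; lia.
by case: nF; apply/existsP; exists x; move: dx; rewrite -!dvdp_XsubCl => /dvdp_trans; apply.
Qed.

Lemma no_three_coprime_roots (F1 F2 F3 : {poly 'F_2}) :
  coprimep F1 F2 -> coprimep F1 F3 -> coprimep F2 F3 ->
  (exists x, root F1 x) -> (exists x, root F2 x) -> (exists x, root F3 x) -> False.
Proof.
move=> c12 c13 c23 [x1 r1] [x2 r2] [x3 r3].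
have neq (P Q : {poly 'F_2}) x y : coprimep P Q -> root P x -> root Q y -> x != y.
  move=> cPQ Px Qy; apply: contraL Qy => /eqP <-.
  exact: coprimep_root cPQ Px.
have := neq _ _ _ _ c12 r1 r2; have := neq _ _ _ _ c13 r1 r3.
have := neq _ _ _ _ c23 r2 r3.
by move: x1 x2 x3 {r1 r2 r3} => [[|[|?]] ?] [[|[|?]] ?] [[|[|?]] ?].
Qed.

(** * Algebraic integers and divisibility by 2 *)

Lemma AintP (x : algC) : x \in Aint <-> integralOver (intr : int -> algC) x.
Proof.
split=> [xA|[p p_mon px]].
  have /floorpP[p Dp] : minCpoly x \is a polyOver Num.int by [].
  exists p; last by rewrite -Dp root_minCpoly.
  have : map_poly (intr : int -> algC) p \is monic by rewrite -Dp minCpoly_monic.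
  by rewrite !monicE (lead_coef_map_inj (@intr_inj algC)) // (eqr_int _ _ 1).
apply: (root_monic_Aint px); first by rewrite monic_map.
by apply/polyOverP => i; rewrite coef_map rpred_int.
Qed.

(** Integrality is transitive. It will be applied to a quadratic equation for a value of [gavg]
    whose coefficients involve another such value. *)
Lemma Aint_root (p : {poly algC}) (x : algC) :
  p \is monic -> p \is a polyOver Aint -> root p x -> x \in Aint.
Proof.
move=> p_mon pA px; apply/AintP; apply: integral_root_monic p_mon px _.
by move=> c cp; apply/AintP; move/allP: pA; apply.
Qed.

Lemma Aint_sqr_root (a b x : algC) :
  a \in Aint -> b \in Aint -> x ^+ 2 = a * x + b -> x \in Aint.
Proof.
move=> aA bA ex; apply: (@Aint_root ('X^2 - (a *: 'X + b%:P))).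
- rewrite monicE lead_coefDl ?lead_coefXn // size_polyXn size_polyN.
  rewrite (leq_ltn_trans (size_polyD _ _)) // gtn_max.
  rewrite (leq_ltn_trans (size_scale_leq _ _)) ?size_polyX //=.
  by rewrite (leq_ltn_trans (size_polyC_leq1 _)).
- by rewrite rpredB ?rpredD ?polyOverZ ?polyOverC ?rpredX ?polyOverX.
- by rewrite /root !hornerE ex subrr.
Qed.

Lemma Aint_expr_root (n : nat) (x : algC) :
  (0 < n)%N -> x ^+ n \in Aint -> x \in Aint.
Proof.
move=> n0 xA; apply: (@Aint_root ('X^n - (x ^+ n)%:P)).
- exact: monicXnsubC.
- by apply: rpredB; [rewrite rpredX ?polyOverX | rewrite polyOverC].
- by rewrite /root !hornerE subrr.
Qed.

Lemma dvd2P (x : algC) : reflect (exists2 y, y \in Aint & x = 2 * y) (2 %| x)%A.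
Proof.
rewrite unfold_in /= pnatr_eq0 /=; apply: (iffP idP) => [xA|[y yA ->]].
  by exists (x / 2) => //; rewrite mulrC divfK ?pnatr_eq0.
by rewrite mulrC mulKf ?pnatr_eq0.
Qed.

Lemma dvd2_mull (x y : algC) : y \in Aint -> (2 %| x)%A -> (2 %| y * x)%A.
Proof.
by move=> yA /dvd2P[z zA ->]; apply/dvd2P; exists (y * z); [rewrite rpredM | ring].
Qed.

(** * Averages of powers as orthogonal idempotents modulo 2 *)

(* The average of the powers x ^+ i, i < 2 ^ j, in factored form. *)
Fixpoint gavg (j : nat) (x : algC) : algC :=
  if j is i.+1 then (1 + x) / 2 * gavg i (x ^+ 2) else 1.

Lemma gavgM j x : 2 ^+ j * (gavg j x * (x - 1)) = x ^+ (2 ^ j) - 1.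
Proof.
elim: j x => [|j IH] x /=; first by rewrite expr1; ring.
by rewrite expnS exprM -IH exprS; field.
Qed.

(** With the exponent [j.+2] a factor 4 survives the division by [2 ^+ j]; it pays for the
    denominators in [gavg_sqr] and [gavg_orth]. *)
Lemma gavg_sub1 j x c : x ^+ (2 ^ j) = 1 + 2 ^+ j.+2 * c%:~R ->
  gavg j x * (x - 1) = 4 * c%:~R.
Proof.
move=> xc; have nz : (2 : algC) ^+ j != 0 by rewrite expf_neq0 // pnatr_eq0.
by apply: (mulfI nz); rewrite gavgM xc !exprS; ring.
Qed.

Lemma Aint_gavg_base j x (c : int) :
  x ^+ (2 ^ j) = 1 + 2 ^+ j.+2 * c%:~R -> x \in Aint.
Proof.
move=> xc; apply: (@Aint_expr_root (2 ^ j)); first by rewrite expn_gt0.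
by rewrite xc rpredD // rpredM ?rpredX ?Aint_int ?(Aint_int 2).
Qed.

(** Induction, passing from x and c to x^2 and 2c. If e is the value at x^2, then E = (1 + x) / 2 *
    e satisfies E^2 = e E + 2 c e, so E is integral even if (1 + x) / 2 is not. In E^2 - E = (1 + x)
    / 2 * (e^2 - e) + 2 c e, the doubled constant in e^2 - e absorbs the denominator. *)
Lemma gavg_sqr j x c : x ^+ (2 ^ j) = 1 + 2 ^+ j.+2 * c%:~R ->
  gavg j x \in Aint /\
  exists2 y, y \in Aint & gavg j x ^+ 2 = gavg j x + 2 * c%:~R * y.
Proof.
elim: j x c => [|j IH] x c xc /=.
  by split=> //; exists 0; rewrite ?Aint0 //; ring.
have x2c : (x ^+ 2) ^+ (2 ^ j) = 1 + 2 ^+ j.+2 * (2 * c)%:~R.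
  by rewrite -exprM -expnS xc intrM exprS; ring.
have [eA [y yA ey]] := IH _ _ x2c.
have xA := Aint_gavg_base _ _ _ xc.
have ec := gavg_sub1 _ _ _ x2c.
set e := gavg j (x ^+ 2) in eA ey ec *.
have cA : c%:~R \in Aint by apply: Aint_int.
rewrite intrM in ey ec.
have e2 : ((1 + x) / 2 * e) ^+ 2 = e * ((1 + x) / 2 * e) + 2 * c%:~R * e.
  have -> : ((1 + x) / 2 * e) ^+ 2 = e * ((1 + x) / 2 * e) + e * (e * (x ^+ 2 - 1)) / 4.
    by field.
  by rewrite ec; field.
split.
  by apply: Aint_sqr_root e2; rewrite // rpredM // rpredM // (Aint_int 2).
exists ((1 + x) * y + e); first by rewrite rpredD // rpredM // rpredD.
have -> : ((1 + x) / 2 * e) ^+ 2 =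
    (1 + x) / 2 * e + (1 + x) / 2 * (e ^+ 2 - e) + 2 * c%:~R * e by rewrite e2; field.
by rewrite ey; field.
Qed.

(** The second average has the factor (1 - x^t) / 2, a multiple of (x - 1) / 2, and [gavg_sub1]
    turns [gavg j x * (x - 1)] into 4c. *)
Lemma gavg_orth j x c i t d : (0 < t)%N ->
  x ^+ (2 ^ j) = 1 + 2 ^+ j.+2 * c%:~R ->
  (- x ^+ t) ^+ (2 ^ i.+1) = 1 + 2 ^+ i.+3 * d%:~R ->
  (2 %| gavg j x * gavg i.+1 (- x ^+ t))%A.
Proof.
move=> t0 xc yd; apply/dvd2P => /=; rewrite sqrrN.
have y2d : ((x ^+ t) ^+ 2) ^+ (2 ^ i) = 1 + 2 ^+ i.+2 * (2 * d)%:~R.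
  by rewrite -[(x ^+ t) ^+ 2]sqrrN -exprM -expnS yd intrM exprS; ring.
have [gA _] := gavg_sqr _ _ _ y2d.
have := gavg_sub1 _ _ _ xc.
set g := gavg j x => ec.
have := subrXX x 1 t; rewrite expr1n; set S := \sum_(_ < _) _ => eS.
have SA : S \in Aint.
  by rewrite rpred_sum // => k _; rewrite expr1n mulr1 rpredX // (Aint_gavg_base _ _ _ xc).
exists (- (c%:~R * S * gavg i ((x ^+ t) ^+ 2))).
  by rewrite rpredN rpredM // rpredM // Aint_int.
have -> : 1 + - x ^+ t = - ((x - 1) * S) by rewrite -eS; ring.
have -> : g * (- ((x - 1) * S) / 2 * gavg i ((x ^+ t) ^+ 2)) =
  - (g * (x - 1)) * S / 2 * gavg i ((x ^+ t) ^+ 2) by field.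
by rewrite ec; field.
Qed.

(** Beyond the Frobenius congruence modulo 2, the error divided by 2 is -1 modulo x - 1. This stands
    in for the Eisenstein condition that the constant term is not divisible by 4. *)
Lemma sub1_exp2 (x : algC) (t : nat) : x \in Aint ->
  exists2 l, l \in Aint &
    (x - 1) ^+ (2 ^ t) = x ^+ (2 ^ t) + 1 + 2 * ((x - 1) * l - 1).
Proof.
move=> xA; elim: t => [|t [l lA IH]].
  by exists 0; rewrite ?Aint0 // !expr1; ring.
have := subrXX x 1 (2 ^ t); rewrite expr1n; set b := \sum_(_ < _) _ => eb.
have bA : b \in Aint.
  by rewrite rpred_sum // => k _; rewrite expr1n mulr1 rpredX.
set a := x - 1 in IH eb *.
have aA : a \in Aint by rewrite rpredB.
have A2 : 2 \in Aint by apply: (Aint_int 2).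
(* With x^(2^t) = 1 + a b the induction hypothesis reads a^(2^t) = a b + 2 a l; squaring it gives
   the witness. *)
exists (2 * (a * l * b) + 2 * (a * l ^+ 2) - b).
  by rewrite rpredB // rpredD // rpredM // rpredM // ?rpredM // rpredX.
have e1 : x ^+ (2 ^ t) = 1 + a * b by rewrite -eb; ring.
by rewrite expnSr !exprM IH e1; ring.
Qed.

(** By [gavg_sub1], x^(2^t) acts on E as -1 up to 4c, so [sub1_exp2] writes E (x - 1)^(2^t) as twice
    an element that is -E modulo 2 and x - 1. If a smaller power already gave an even product, this
    element would be a multiple of x - 1. *)
Lemma gavg_nilpotent j t (x : algC) c :
  (- x ^+ (2 ^ t)) ^+ (2 ^ j) = 1 + 2 ^+ j.+2 * c%:~R ->
  let E := gavg j (- x ^+ (2 ^ t)) in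
  ~~ (2 %| E)%A ->
  (2 %| E * (x - 1) ^+ (2 ^ t))%A /\ ~~ (2 %| E * (x - 1) ^+ (2 ^ t).-1)%A.
Proof.
move=> yc E E2.
have [EA [u uA Esq]] := gavg_sqr _ _ _ yc; rewrite -/E in EA Esq.
have ec := gavg_sub1 _ _ _ yc; rewrite -/E in ec.
have xA : x \in Aint.
  apply: (@Aint_expr_root (2 ^ t)); first by rewrite expn_gt0.
  by rewrite -rpredN (Aint_gavg_base _ _ _ yc).
have [l lA el] := sub1_exp2 _ t xA.
set a := x - 1 in el *; have aA : a \in Aint by rewrite rpredB.
have A2 : 2 \in Aint by apply: (Aint_int 2).
have cA : c%:~R \in Aint by apply: Aint_int.
have Ea : E * a ^+ (2 ^ t) = 2 * (E * (a * l - 1) - 2 * c%:~R).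
  rewrite el.
  have -> : E * (x ^+ (2 ^ t) + 1 + 2 * (a * l - 1)) =
    - (E * (- x ^+ (2 ^ t) - 1)) + 2 * (E * (a * l - 1)) by ring.
  by rewrite ec; ring.
split.
  by apply/dvd2P; eexists; last exact: Ea; rewrite !(rpredB, rpredM).
apply: contra E2 => /dvd2P[z zA ez].
have az : a * z = E * (a * l - 1) - 2 * c%:~R.
  apply: (@mulfI _ 2); first by rewrite pnatr_eq0.
  rewrite -Ea -[in RHS](@prednK (2 ^ t)) ?expn_gt0 //.
  by rewrite exprS mulrA [E * a]mulrC -mulrA ez; ring.
(* Hence E is a multiple of a modulo 2, so that E = E ^ (2 ^ t).+1 is one of E * a ^ (2 ^ t),
   which is even. *)
have E1 : E = a * (E * l - z) - 2 * c%:~R.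
  by rewrite mulrBr az; ring.
set y := E * l - z in E1; have yA : y \in Aint by rewrite rpredB // rpredM.
have modE : (E == a * y %[mod 2])%A.
  rewrite /eqAmod {1}E1; apply/dvd2P; exists (- c%:~R); first by rewrite rpredN.
  by ring.
have modEM : (E ^+ 2 == E %[mod 2])%A.
  rewrite /eqAmod Esq; apply/dvd2P; exists (c%:~R * u); first by rewrite rpredM.
  by ring.
have modX k : (E ^+ k.+1 == E %[mod 2])%A.
  elim: k => [|k IH]; first by rewrite expr1 eqAmod_refl.
  rewrite exprS; apply: eqAmod_trans modEM.
  by rewrite expr2; apply: eqAmodMl.
have modXy k : (E ^+ k == (a * y) ^+ k %[mod 2])%A.
  elim: k => [|k IH]; first by rewrite eqAmod_refl.
  by rewrite !exprS eqAmodM // rpredX // rpredM.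
have := eqAmodMl EA (modXy (2 ^ t)%N); rewrite -exprS => EE.
rewrite -eqAmod0 -(eqAmod_transl _ (modX (2 ^ t)%N)) (eqAmod_transl _ EE) eqAmod0.
rewrite exprMn mulrA mulrC dvd2_mull ?rpredX // Ea.
by apply/dvd2P; eexists; last by []; rewrite !(rpredB, rpredM).
Qed.

(** * Conjugation of the radical, and averages that are not even *)

Lemma irr_dvdp (p q : {poly rat}) (x : algC) :
  irreducible_poly p -> root (map_poly ratr p) x -> root (map_poly ratr q) x ->
  p %| q.
Proof.
have [p0 [Dp0 _] dvd_p0] := minCpolyP x.
move=> irr_p; rewrite !dvd_p0 => p0p; apply: dvdp_trans.
suff /(apply_irredp irr_p) /(_ p0p) : size p0 != 1 by rewrite /eqp => /andP[].
by rewrite -(size_map_poly (ratr : rat -> algC)) -Dp0 neq_ltn size_minCpoly orbT.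
Qed.

(** If g is a monic integer polynomial vanishing at p(alpha), then g(p(X)) vanishes at alpha, so it
    is a multiple of X^n - m and vanishes at z alpha too. *)
Lemma Aint_conj (n : nat) (m : int) (alpha z : algC) (p : {poly rat}) :
  irreducible_poly ('X^n - (m%:~R)%:P : {poly rat}) ->
  alpha ^+ n = m%:~R -> z ^+ n = 1 ->
  (map_poly ratr p).[alpha] \in Aint -> (map_poly ratr p).[z * alpha] \in Aint.
Proof.
move=> irr_n an zn /AintP[g g_mon gp].
have comp x : (map_poly ratr (map_poly intr g \Po p)).[x] =
    (map_poly intr g).[(map_poly (ratr : rat -> algC) p).[x]].
  rewrite map_comp_poly horner_comp -map_poly_comp.
  by congr _.[_]; apply: eq_map_poly => i /=; rewrite ratr_int.
have dvd : 'X^n - (m%:~R)%:P %| map_poly intr g \Po p.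
  apply: (irr_dvdp _ _ alpha irr_n).
    by rewrite /root rmorphB /= map_polyXn map_polyC /= ratr_int !hornerE an subrr.
  by rewrite /root comp.
apply/AintP; exists g => //; rewrite /root -comp.
rewrite -(dvdp_map (ratr : {rmorphism rat -> algC})) in dvd.
have /dvdpP[h ->] := dvd.
rewrite hornerM rmorphB /= map_polyXn map_polyC /= ratr_int !hornerE.
by rewrite exprMn zn an mul1r subrr mulr0.
Qed.

(** A rational polynomial is needed to conjugate averages and to see that they lie in Q(alpha). *)
Lemma gavg_poly (j : nat) :
  exists p : {poly rat}, forall x, gavg j x = (map_poly ratr p).[x].
Proof.
elim: j => [|j [p IH]] /=; first by exists 1 => x; rewrite rmorph1 hornerC.
exists ((2^-1)%:P * (1 + 'X) * (p \Po 'X^2)) => x.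
rewrite !rmorphM rmorphD rmorph1 /= map_polyC map_polyX map_comp_poly map_polyXn.
by rewrite !hornerE horner_comp !hornerE -IH /= fmorphV rmorph_nat; field.
Qed.

(** Descent: evenness for [j.+1] and [e] passes to [j] and [2 * e], and ends at the value 1, which
    is not even. *)
Lemma gavg_not_even (n : nat) (m : int) (alpha : algC) (j e : nat) (b : bool) :
  irreducible_poly ('X^n - (m%:~R)%:P : {poly rat}) ->
  alpha ^+ n = m%:~R -> (0 < n)%N -> (e * 2 ^ j)%N = n ->
  ~~ (2 %| gavg j ((-1) ^+ b * alpha ^+ e))%A.
Proof.
move=> irr_n an n0.
elim: j e b => [|j IH] e b en.
  by have := eqAmod0_nat 2 1; rewrite eqAmod0 => ->.
have e0 : (0 < e)%N by move: n0; rewrite -en muln_gt0 => /andP[].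
apply: contra (IH (2 * e)%N false _) => [|]; last by rewrite -en expnS; lia.
rewrite expr0 mul1r.
have [p Dp] := gavg_poly j.+1.
pose q := 2^-1 *: (p \Po ((-1) ^+ b *: 'X^e)).
have Dq x : (map_poly ratr q).[x] = gavg j.+1 ((-1) ^+ b * x ^+ e) / 2.
  rewrite Dp /q map_polyZ map_comp_poly hornerZ horner_comp map_polyZ hornerZ.
  by rewrite map_polyXn hornerXn fmorphV rmorph_nat rmorph_sign mulrC.
rewrite unfold_in /= pnatr_eq0 /= -[_ / 2]Dq => qA.
(* Here n is an even multiple of e, so an e-th root of -1 is an n-th root of unity. *)
pose z : algC := e.-root (-1).
have ze : z ^+ e = -1 by apply: rootCK.
have zn : z ^+ n = 1 by rewrite -en exprM ze expnS exprM sqrrN !expr1n.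
(* The conjugation alpha -> z * alpha changes the sign of the argument of gavg, and the two
   conjugates have sum gavg j (alpha ^ (2 e)). *)
have := rpredD qA (Aint_conj _ _ _ _ _ irr_n an zn qA).
rewrite !Dq exprMn ze /= mulN1r mulrN sqrrN exprMn sqrr_sign mul1r -exprM mulnC => sA.
apply/dvd2P; eexists; first exact: sA.
by field.
Qed.

(** * The ring Z[theta] modulo 2 *)

(** The n + 1 remainders of the powers of [q] modulo [p] lie in a space of dimension n; a linear
    relation between them is a polynomial of degree at most n vanishing at theta. *)
Lemma size_minCpoly_adj (n : nat) (p : {poly rat}) (x : algC) :
  p != 0 -> size p = n.+1 -> root (map_poly ratr p) x ->
  forall theta, in_Qadj x theta -> (size (minCpoly theta) <= n.+1)%N.
Proof.
move=> p0 pn px theta [q ->].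
pose A := \matrix_(i < n.+1) (poly_rV (q ^+ i %% p) : 'rV_n).
have /rowV0Pn[u /sub_kermxP uA u0] : kermx A != 0.
  rewrite kermx_eq0; apply: contraL (rank_leq_col A) => /eqP ->.
  by rewrite ltnn.
pose P : {poly rat} := \poly_(i < n.+1) u 0 (inord i).
have P0 : P != 0.
  apply: contraNneq u0 => P0; apply/eqP/rowP => i.
  by have := coef_poly n.+1 (fun i => u 0 (inord i)) i; rewrite -/P P0 coef0 ltn_ord inord_val mxE => <-.
have modE i : (map_poly (ratr : rat -> algC) (q ^+ i %% p)).[x] = (map_poly ratr q).[x] ^+ i.
  rewrite -horner_exp -rmorphXn /= [in RHS](divp_eq (q ^+ i) p).
  by rewrite rmorphD rmorphM /= hornerD hornerM (rootP px) mulr0 add0r.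
have sum0 : \sum_(i < n.+1) u 0 i *: (q ^+ i %% p) = 0.
  have := congr1 rVpoly uA; rewrite linear0 mulmx_sum_row linear_sum => /= S0.
  rewrite -[RHS]S0; apply: eq_bigr => i _; rewrite linearZ /= rowK poly_rV_K //.
  by have := ltn_modp (q ^+ i) p; rewrite p0 pn ltnS.
have rootP' : root (map_poly ratr P) (map_poly ratr q).[x].
  have := congr1 (fun r => (map_poly (ratr : rat -> algC) r).[x]) sum0.
  rewrite rmorph0 hornerC rmorph_sum horner_sum => /= S0.
  apply/eqP; rewrite -[RHS]S0; rewrite /P poly_def rmorph_sum horner_sum; apply: eq_bigr => i _ /=.
  by rewrite !map_polyZ !hornerZ map_polyXn hornerXn modE inord_val.
have [g [Dg _] dvd_g] := minCpolyP (map_poly ratr q).[x].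
rewrite Dg size_map_poly (leq_trans (dvdp_leq P0 _)) ?size_poly //.
by rewrite -dvd_g.
Qed.

(** Division by the monic f stays over the integers, and its remainder, vanishing at theta, is 0 by
    minimality over the rationals. *)
Lemma Aint_minpoly (theta : algC) : theta \in Aint ->
  exists f : {poly int}, [/\ f \is monic, map_poly intr f = minCpoly theta &
    forall q : {poly int}, (map_poly intr q).[theta] = 0 -> exists h, q = h * f].
Proof.
move=> thA; have /floorpP[f Df] : minCpoly theta \is a polyOver Num.int by [].
have f_mon : f \is monic.
  have := minCpoly_monic theta; rewrite Df.
  by rewrite !monicE (lead_coef_map_inj (@intr_inj algC)) // (eqr_int _ _ 1).
exists f; split=> // q qth; exists (Pdiv.Ring.rdivp q f).
have dq := Pdiv.RingMonic.rdivp_eq f_mon q.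
suff r0 : Pdiv.Ring.rmodp q f = 0 by rewrite {1}dq r0 addr0.
have szr : (size (Pdiv.Ring.rmodp q f) < size f)%N.
  by rewrite Pdiv.Ring.ltn_rmodp monic_neq0.
set s := Pdiv.Ring.rmodp q f in dq szr *.
have sth : root (map_poly ratr (map_poly intr s : {poly rat})) theta.
  rewrite -map_poly_comp (eq_map_poly (g := intr)); last by move=> i /=; rewrite ratr_int.
  apply/eqP; move: qth; rewrite dq rmorphD rmorphM /= -Df hornerD hornerM.
  by rewrite (rootP (root_minCpoly theta)) mulr0 add0r.
have [g [Dg _] dvd_g] := minCpolyP theta.
apply/eqP; apply: contraLR szr => s0; rewrite -leqNgt.
have s0' : map_poly intr s != 0 :> {poly rat} by rewrite map_poly_eq0_id0 // intr_eq0 lead_coef_eq0.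
rewrite dvd_g in sth; have := dvdp_leq s0' sth.
rewrite -(size_map_poly (ratr : rat -> algC)) -Dg Df.
by rewrite !size_map_inj_poly //; apply: intr_inj.
Qed.

Lemma F2_lift (p : {poly 'F_2}) : exists q : {poly int}, p = map_poly intr q.
Proof.
exists (map_poly (fun a : 'F_2 => (a : nat)%:Z) p).
by apply/polyP => i; rewrite !coef_map_id0 //= -[LHS]natr_Zp pmulrn.
Qed.

Lemma F2_red_eq0 (p : {poly int}) :
  map_poly intr p = 0 :> {poly 'F_2} -> exists q, p = 2 *: q.
Proof.
move=> p0; exists (map_poly (fun a => (a %/ 2)%Z) p).
apply/polyP => i; rewrite coefZ coef_map_id0 ?div0z // mulrC divzK //.
rewrite (dvdz_pcharf (pchar_Fp (isT : prime 2))) -coef_map p0 coef0.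
done.
Qed.

(** If q(theta) is even, its half is an integer of K, hence some h(theta), and q - 2h is a multiple
    of the integral minimal polynomial. Conversely, a cofactor modulo 2 is lifted to the
    integers. *)
Lemma Aint_minpoly_red (alpha theta : algC) :
  (forall x, in_ring_of_integers alpha x <-> in_Zadj theta x) ->
  exists f : {poly 'F_2}, [/\ f != 0, size f = size (minCpoly theta) &
    forall q : {poly int}, (2 %| (map_poly intr q).[theta])%A = (f %| map_poly intr q)].
Proof.
move=> OK.
have [_ thA] : in_ring_of_integers alpha theta.
  by apply/OK; exists 'X; rewrite map_polyX hornerX.
have [f [f_mon Df dvd_f]] := Aint_minpoly _ thA.
have fr_mon : map_poly intr f \is @monic 'F_2 by rewrite monic_map.
exists (map_poly intr f); split; first exact: monic_neq0.
  rewrite -Df (size_map_inj_poly (@intr_inj algC)) //.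
  by rewrite size_map_poly_id0 // (monicP f_mon) oner_eq0.
move=> q; apply/idP/idP => [q2|/dvdpP[h Dh]].
  have /OK[h Dh] : in_ring_of_integers alpha ((map_poly intr q).[theta] / 2).
    have [/= [s Ds] _] : in_ring_of_integers alpha (map_poly intr q).[theta].
      by apply/OK; exists q.
    split; last by have /dvd2P[y yA ->] := q2; rewrite mulrC mulKf ?pnatr_eq0.
    by exists (2^-1 *: s); rewrite Ds map_polyZ hornerZ /= fmorphV rmorph_nat mulrC.
  have [|k Dk] := dvd_f (q - 2 *: h).
    by rewrite rmorphB /= map_polyZ /= hornerD hornerN hornerZ -Dh; field.
  have -> : q = k * f + 2 *: h by rewrite -Dk subrK.
  rewrite rmorphD rmorphM /= map_polyZ /= (_ : 2%:~R = 0) ?scale0r ?addr0 ?dvdp_mull //; exact/val_inj.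
have [h' Dh'] := F2_lift h.
have [|k Dk] := F2_red_eq0 (q - h' * f).
  by rewrite rmorphB rmorphM /= -Dh' Dh subrr.
apply/dvd2P; exists (map_poly intr k).[theta]; last first.
  have -> : q = h' * f + 2 *: k by rewrite -Dk addrC subrK.
  rewrite rmorphD rmorphM /= map_polyZ /= hornerD hornerM Df.
  by rewrite (rootP (root_minCpoly theta)) mulr0 add0r hornerZ.
by have [] : in_ring_of_integers alpha (map_poly intr k).[theta] by apply/OK; exists k.
Qed.

(** * The components of f attached to the averages *)

Lemma in_Zadj_gavg (alpha theta : algC) (j e : nat) (c : int) (b : bool) :
  (forall x, in_ring_of_integers alpha x <-> in_Zadj theta x) ->
  ((-1) ^+ b * alpha ^+ e) ^+ (2 ^ j) = 1 + 2 ^+ j.+2 * c%:~R ->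
  in_Zadj theta (gavg j ((-1) ^+ b * alpha ^+ e)).
Proof.
move=> OK xc; apply/OK; split; last by case: (gavg_sqr _ _ _ xc).
have [p Dp] := gavg_poly j.
exists (p \Po ((-1) ^+ b *: 'X^e)).
rewrite Dp map_comp_poly horner_comp map_polyZ hornerZ.
by rewrite map_polyXn hornerXn rmorph_sign.
Qed.

Lemma gavg_red_idem (theta : algC) (f : {poly 'F_2}) (j : nat) (x : algC) (c : int)
  (Q : {poly int}) :
  (forall q : {poly int}, (2 %| (map_poly intr q).[theta])%A = (f %| map_poly intr q)) ->
  x ^+ (2 ^ j) = 1 + 2 ^+ j.+2 * c%:~R ->
  gavg j x = (map_poly intr Q).[theta] ->
  f %| map_poly intr Q * (1 - map_poly intr Q).
Proof.
move=> red xc DQ; have [_ [y yA ey]] := gavg_sqr _ _ _ xc.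
rewrite -(rmorph1 (map_poly (intr : int -> 'F_2))) -rmorphB -rmorphM /= -red.
rewrite rmorphM rmorphB rmorph1 /= hornerM hornerD hornerN hornerC -DQ.
apply/dvd2P; exists (- (c%:~R * y)); first by rewrite rpredN rpredM ?Aint_int.
by rewrite mulrBr mulr1 -expr2 ey; ring.
Qed.

Lemma coprimep_red_idem (theta : algC) (f : {poly 'F_2}) (Q Q' : {poly int}) :
  (forall q : {poly int}, (2 %| (map_poly intr q).[theta])%A = (f %| map_poly intr q)) ->
  (2 %| (map_poly intr Q).[theta] * (map_poly intr Q').[theta])%A ->
  coprimep (gcdp f (1 - map_poly intr Q)) (gcdp f (1 - map_poly intr Q')).
Proof. by move=> red; rewrite -hornerM -rmorphM red rmorphM => /coprimep_idem. Qed.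

Lemma gavg_component_pos (n : nat) (m : int) (alpha theta : algC) (f : {poly 'F_2})
  (j e : nat) (c : int) :
  irreducible_poly ('X^n - (m%:~R)%:P : {poly rat}) ->
  alpha ^+ n = m%:~R -> (0 < n)%N -> (e * 2 ^ j)%N = n -> m = 1 + 2 ^+ j.+2 * c ->
  (forall x, in_ring_of_integers alpha x <-> in_Zadj theta x) -> f != 0 ->
  (forall q : {poly int}, (2 %| (map_poly intr q).[theta])%A = (f %| map_poly intr q)) ->
  exists2 Q : {poly int}, gavg j (alpha ^+ e) = (map_poly intr Q).[theta] &
    let F := gcdp f (1 - map_poly intr Q) in
    (1 < size F)%N /\ ((2 < size F)%N \/ exists x, root F x).
Proof.
move=> irr_n an n0 en mc OK f0 red.
have xc : (alpha ^+ e) ^+ (2 ^ j) = 1 + 2 ^+ j.+2 * c%:~R.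
  by rewrite -exprM en an mc intrD intrM rmorphXn.
have [Q DQ] : in_Zadj theta (gavg j (alpha ^+ e)).
  have := in_Zadj_gavg _ _ j e c false OK; rewrite expr0 mul1r; exact.
(* With [a = 0] and [e = 0] the nilpotency conditions only say that f does not divide the
   idempotent; the degree is then at least 1, and at least 2 without roots. *)
exists Q => //; apply: (idem_component_size _ _ 0 0) => //.
- exact: gavg_red_idem red xc DQ.
- by rewrite expr1 mulr0 dvdp0.
rewrite expr0 mulr1 -red -DQ.
by have := gavg_not_even _ _ _ j e false irr_n an n0 en; rewrite expr0 mul1r.
Qed.

(** In the 2-adic integers m is w^(2^(j+1)) with w = 1 modulo 4, and the component belongs to the
    factor X^(2^t) + w of X^n - m. Its degree is recovered as the nilpotency order of alpha - 1. *)
Lemma gavg_component_neg (n : nat) (m : int) (alpha theta : algC) (f : {poly 'F_2})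
  (j t : nat) (c : int) :
  irreducible_poly ('X^n - (m%:~R)%:P : {poly rat}) ->
  alpha ^+ n = m%:~R -> (2 ^ t * 2 ^ j.+1)%N = n -> m = 1 + 2 ^+ j.+3 * c ->
  (forall x, in_ring_of_integers alpha x <-> in_Zadj theta x) -> f != 0 ->
  (forall q : {poly int}, (2 %| (map_poly intr q).[theta])%A = (f %| map_poly intr q)) ->
  exists2 Q : {poly int}, gavg j.+1 (- alpha ^+ (2 ^ t)) = (map_poly intr Q).[theta] &
    let F := gcdp f (1 - map_poly intr Q) in
    (2 ^ t < size F)%N /\ ((2 * 2 ^ t < size F)%N \/ exists x, root F x).
Proof.
move=> irr_n an tn mc OK f0 red.
have n0 : (0 < n)%N by rewrite -tn muln_gt0 !expn_gt0.
have xc : (- alpha ^+ (2 ^ t)) ^+ (2 ^ j.+1) = 1 + 2 ^+ j.+3 * c%:~R.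
  rewrite expnS exprM sqrrN -exprM -expnS -exprM tn.
  by rewrite an mc intrD intrM rmorphXn.
have [Q DQ] : in_Zadj theta (gavg j.+1 (- alpha ^+ (2 ^ t))).
  have := in_Zadj_gavg _ _ j.+1 (2 ^ t)%N c true OK; rewrite expr1 mulN1r; exact.
have odd_g : ~~ (2 %| gavg j.+1 (- alpha ^+ (2 ^ t)))%A.
  by have := gavg_not_even _ _ _ _ _ true irr_n an n0 tn; rewrite expr1 mulN1r.
have [nil1 nil2] := gavg_nilpotent _ _ _ _ xc odd_g.
have [A DA] : in_Zadj theta (alpha - 1).
  apply/OK; split.
    by exists ('X - 1); rewrite rmorphB rmorph1 /= map_polyX !hornerE.
  rewrite rpredB //; apply: (@Aint_expr_root n) => //.
  by rewrite an Aint_int.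
have redX k : (2 %| gavg j.+1 (- alpha ^+ (2 ^ t)) * (alpha - 1) ^+ k)%A =
    (f %| map_poly intr Q * map_poly intr A ^+ k).
  by rewrite -rmorphXn -rmorphM /= -red rmorphM rmorphXn hornerM horner_exp -DQ -DA.
rewrite !redX in nil1 nil2.
have t0 : (2 ^ t).-1.+1 = (2 ^ t)%N by rewrite prednK ?expn_gt0.
exists Q => //.
have := idem_component_size f _ (map_poly intr A) (2 ^ t).-1 f0 (gavg_red_idem _ _ _ _ _ _ red xc DQ).
rewrite t0; exact.
Qed.

(** As a < b, the exponent 2^(b - a) is even and absorbs the sign of -alpha^(2^a), which brings the
    pair into the form of [gavg_orth]. *)
Lemma gavg_orthN (n : nat) (m : int) (alpha : algC) (j a i b : nat) (c d : int) :
  alpha ^+ n = m%:~R -> (a < b)%N ->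
  (2 ^ a * 2 ^ j.+1)%N = n -> (2 ^ b * 2 ^ i.+1)%N = n ->
  m = 1 + 2 ^+ j.+3 * c -> m = 1 + 2 ^+ i.+3 * d ->
  (2 %| gavg j.+1 (- alpha ^+ (2 ^ a)) * gavg i.+1 (- alpha ^+ (2 ^ b)))%A.
Proof.
move=> an ab na nb mc md.
have pw (k l : nat) (z : int) : (2 ^ k * 2 ^ l.+1)%N = n -> m = 1 + 2 ^+ l.+3 * z ->
    (- alpha ^+ (2 ^ k)) ^+ (2 ^ l.+1) = 1 + 2 ^+ l.+3 * z%:~R.
  move=> kl mz; rewrite expnS exprM sqrrN -exprM -expnS -exprM kl.
  by rewrite an mz intrD intrM rmorphXn.
have e : - alpha ^+ (2 ^ b) = - (- alpha ^+ (2 ^ a)) ^+ (2 ^ (b - a)).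
  rewrite -(subnSK ab) expnS exprM sqrrN -!exprM -expnS -expnD.
  by rewrite subnSK // subnKC // ltnW.
rewrite e; apply: gavg_orth (expn_gt0 2 _) (pw _ _ _ na mc) _.
by rewrite -e; apply: pw nb md.
Qed.

Lemma gavg_orth_pos (n : nat) (m : int) (alpha : algC) (j a i b : nat) (c d : int) :
  alpha ^+ n = m%:~R -> (a <= b)%N ->
  (2 ^ a * 2 ^ j)%N = n -> (2 ^ b * 2 ^ i.+1)%N = n ->
  m = 1 + 2 ^+ j.+2 * c -> m = 1 + 2 ^+ i.+3 * d ->
  (2 %| gavg j (alpha ^+ (2 ^ a)) * gavg i.+1 (- alpha ^+ (2 ^ b)))%A.
Proof.
move=> an ab na nb mc md.
have e : - alpha ^+ (2 ^ b) = - (alpha ^+ (2 ^ a)) ^+ (2 ^ (b - a)).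
  by rewrite -exprM -expnD subnKC.
rewrite e; apply: (gavg_orth _ _ c _ _ d); first by rewrite expn_gt0.
  by rewrite -exprM na an mc intrD intrM rmorphXn.
rewrite -e expnS exprM sqrrN -exprM -expnS -exprM nb.
by rewrite an md intrD intrM rmorphXn.
Qed.

(** * Counting degrees *)

Lemma modz_eq1 (m : int) (k : nat) : (m = 1 %[mod (2 ^ k)%N])%Z ->
  exists c : int, m = 1 + 2 ^+ k * c.
Proof.
move/eqP; rewrite eqz_mod_dvd => /dvdzP[c ec]; exists c.
by rewrite mulrC -natrX natz -ec; ring.
Qed.

Lemma size_mul_coprime_dvdp (K : fieldType) (f F G : {poly K}) :
  f != 0 -> coprimep F G -> F %| f -> G %| f ->
  F * G %| f /\ (size (F * G)).-1 = ((size F).-1 + (size G).-1)%N.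
Proof.
move=> f0 cFG Ff Gf; rewrite Gauss_dvdp // Ff Gf; split=> //.
have F0 : F != 0 by apply: contraNneq f0 => F0; move: Ff; rewrite F0 dvd0p.
have G0 : G != 0 by apply: contraNneq f0 => G0; move: Gf; rewrite G0 dvd0p.
rewrite size_mul //; move: F0 G0; rewrite -!size_poly_gt0.
by case: (size F) (size G) => [|k] [|l] //= _ _; rewrite addnS.
Qed.

Theorem theorem2p5 (r : nat) (m : int) (alpha : algC) :
  (0 < r)%N -> m != 1 -> squarefree_int m ->
  irreducible_poly ('X^(2 ^ r) - (m%:~R)%:P : {poly rat}) ->
  alpha ^+ (2 ^ r) = m%:~R ->
  (((r = 2)%N /\ (m = 1 %[mod 16])%Z) -> ~ monogenic alpha) /\
  (((3 <= r)%N /\ (m = 1 %[mod 32])%Z) -> ~ monogenic alpha).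
Proof.
move=> r0 _ _ irr_r ar.
have n0 : (0 < 2 ^ r)%N by rewrite expn_gt0.
have setup : monogenic alpha -> exists theta, exists f : {poly 'F_2}, [/\ f != 0,
    (size f <= (2 ^ r).+1)%N,
    (forall x, in_ring_of_integers alpha x <-> in_Zadj theta x) &
    (forall q : {poly int}, (2 %| (map_poly intr q).[theta])%A = (f %| map_poly intr q))].
  move=> [theta [[thK _] OK]]; exists theta.
  have [f [f0 sf red]] := Aint_minpoly_red _ _ OK; exists f; split=> //.
  rewrite sf; apply: (size_minCpoly_adj _ ('X^(2 ^ r) - (m%:~R)%:P) alpha) thK.
  - exact: irredp_neq0 irr_r.
  - by rewrite size_XnsubC.
  - by rewrite /root rmorphB /= map_polyXn map_polyC /= ratr_int !hornerE ar subrr.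
split=> [[r2 m1]|[r3 m1]] /setup[theta [f [f0 sf OK red]]].
(* The components of alpha, -alpha and -alpha^2 have degrees at least 1, 1 and 2, with sum n = 4. A
   component without a root would have twice its bound, so all three have roots. *)
- have [c mc] := modz_eq1 _ 4 m1.
  have mc1 : m = 1 + 2 ^+ 3 * (2 * c) by rewrite mc; ring.
  have n20 : (2 ^ 0 * 2 ^ 2)%N = (2 ^ r)%N by rewrite r2.
  have n11 : (2 ^ 1 * 2 ^ 1)%N = (2 ^ r)%N by rewrite r2.
  have [Q0 D0 [s0 t0]] := gavg_component_pos _ _ _ _ _ 2 _ c irr_r ar n0 n20 mc OK f0 red.
  have [Q1 D1 [s1 t1]] := gavg_component_neg _ _ _ _ _ 1 0 c irr_r ar n20 mc OK f0 red.
  have [Q2 D2 [s2 t2]] := gavg_component_neg _ _ _ _ _ 0 1 _ irr_r ar n11 mc1 OK f0 red.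
  have orth (Q Q' : {poly int}) := coprimep_red_idem _ _ Q Q' red.
  have c01 : coprimep (gcdp f (1 - map_poly intr Q0)) (gcdp f (1 - map_poly intr Q1)).
    by apply: orth; rewrite -D0 -D1; apply: (gavg_orth_pos _ _ _ _ _ _ _ _ _ ar _ n20 n20 mc mc).
  have c02 : coprimep (gcdp f (1 - map_poly intr Q0)) (gcdp f (1 - map_poly intr Q2)).
    by apply: orth; rewrite -D0 -D2; apply: (gavg_orth_pos _ _ _ _ _ _ _ _ _ ar _ n20 n11 mc mc1).
  have c12 : coprimep (gcdp f (1 - map_poly intr Q1)) (gcdp f (1 - map_poly intr Q2)).
    by apply: orth; rewrite -D1 -D2; apply: (gavg_orthN _ _ _ _ _ _ _ _ _ ar _ n20 n11 mc mc1).
  have d0 := dvdp_gcdl f (1 - map_poly intr Q0).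
  have d1 := dvdp_gcdl f (1 - map_poly intr Q1).
  have d2 := dvdp_gcdl f (1 - map_poly intr Q2).
  move: s0 t0 s1 t1 s2 t2 c01 c02 c12 d0 d1 d2.
  set F0 := gcdp f _; set F1 := gcdp f _; set F2 := gcdp f _.
  move=> s0 t0 s1 t1 s2 t2 c01 c02 c12 d0 d1 d2.
  have [d12 e12] := size_mul_coprime_dvdp _ _ _ _ f0 c12 d1 d2.
  have c012 : coprimep F0 (F1 * F2) by rewrite coprimepMr c01 c02.
  have [d012 e012] := size_mul_coprime_dvdp _ _ _ _ f0 c012 d0 d12.
  have szf := leq_trans (dvdp_leq f0 d012) sf; rewrite r2 in szf.
  have no3 := no_three_coprime_roots _ _ _ c01 c02 c12.
  move: s0 t0 s1 t1 s2 t2 e12 e012 szf no3; clear.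
  move: (size F0) (size F1) (size F2) (size (F1 * F2)) (size (F0 * (F1 * F2))).
  move=> a0 a1 a2 a12 a012 s0 t0 s1 t1 s2 t2 e12 e012 szf; apply.
  - by case: t0 => // t0; lia.
  - by case: t1 => // t1; lia.
  - by case: t2 => // t2; lia.
(* With s = 2^t and n = 8 s, the components of alpha^s, -alpha^s, -alpha^(2s) and -alpha^(4s) have
   degrees at least 1, s, 2s and 4s. The sum 1 + 7s leaves room for at most s - 1 more, so none of
   the last three bounds can double and these three components have roots. *)
have [c mc] := modz_eq1 _ 5 m1.
have mc1 : m = 1 + 2 ^+ 4 * (2 * c) by rewrite mc; ring.
have mc2 : m = 1 + 2 ^+ 3 * (4 * c) by rewrite mc; ring.
have [t rt] : exists t, r = t.+3 by exists (r - 3)%N; lia.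
have n0' : (2 ^ t * 2 ^ 3)%N = (2 ^ r)%N by rewrite -expnD rt addn3.
have n1 : (2 ^ t.+1 * 2 ^ 2)%N = (2 ^ r)%N by rewrite -expnD rt addn2.
have n2 : (2 ^ t.+2 * 2 ^ 1)%N = (2 ^ r)%N by rewrite -expnD rt addn1.
have [Q0 D0 [s0 t0]] := gavg_component_pos _ _ _ _ _ 3 _ c irr_r ar n0 n0' mc OK f0 red.
have [Q1 D1 [s1 t1]] := gavg_component_neg _ _ _ _ _ 2 _ c irr_r ar n0' mc OK f0 red.
have [Q2 D2 [s2 t2]] := gavg_component_neg _ _ _ _ _ 1 _ _ irr_r ar n1 mc1 OK f0 red.
have [Q3 D3 [s3 t3]] := gavg_component_neg _ _ _ _ _ 0 _ _ irr_r ar n2 mc2 OK f0 red.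
have orth (Q Q' : {poly int}) := coprimep_red_idem _ _ Q Q' red.
have c01 : coprimep (gcdp f (1 - map_poly intr Q0)) (gcdp f (1 - map_poly intr Q1)).
  by apply: orth; rewrite -D0 -D1; apply: (gavg_orth_pos _ _ _ _ _ _ _ _ _ ar _ n0' n0' mc mc).
have c02 : coprimep (gcdp f (1 - map_poly intr Q0)) (gcdp f (1 - map_poly intr Q2)).
  by apply: orth; rewrite -D0 -D2; apply: (gavg_orth_pos _ _ _ _ _ _ _ _ _ ar _ n0' n1 mc mc1).
have c03 : coprimep (gcdp f (1 - map_poly intr Q0)) (gcdp f (1 - map_poly intr Q3)).
  by apply: orth; rewrite -D0 -D3; apply: (gavg_orth_pos _ _ _ _ _ _ _ _ _ ar _ n0' n2 mc mc2); lia.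
have c12 : coprimep (gcdp f (1 - map_poly intr Q1)) (gcdp f (1 - map_poly intr Q2)).
  by apply: orth; rewrite -D1 -D2; apply: (gavg_orthN _ _ _ _ _ _ _ _ _ ar _ n0' n1 mc mc1).
have c13 : coprimep (gcdp f (1 - map_poly intr Q1)) (gcdp f (1 - map_poly intr Q3)).
  by apply: orth; rewrite -D1 -D3; apply: (gavg_orthN _ _ _ _ _ _ _ _ _ ar _ n0' n2 mc mc2); lia.
have c23 : coprimep (gcdp f (1 - map_poly intr Q2)) (gcdp f (1 - map_poly intr Q3)).
  by apply: orth; rewrite -D2 -D3; apply: (gavg_orthN _ _ _ _ _ _ _ _ _ ar _ n1 n2 mc1 mc2).
have d0 := dvdp_gcdl f (1 - map_poly intr Q0).
have d1 := dvdp_gcdl f (1 - map_poly intr Q1).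
have d2 := dvdp_gcdl f (1 - map_poly intr Q2).
have d3 := dvdp_gcdl f (1 - map_poly intr Q3).
move: s0 s1 t1 s2 t2 s3 t3 c01 c02 c03 c12 c13 c23 d0 d1 d2 d3.
set F0 := gcdp f _; set F1 := gcdp f _; set F2 := gcdp f _; set F3 := gcdp f _.
move=> s0 s1 t1 s2 t2 s3 t3 c01 c02 c03 c12 c13 c23 d0 d1 d2 d3.
have [d23 e23] := size_mul_coprime_dvdp _ _ _ _ f0 c23 d2 d3.
have c123 : coprimep F1 (F2 * F3) by rewrite coprimepMr c12 c13.
have [d123 e123] := size_mul_coprime_dvdp _ _ _ _ f0 c123 d1 d23.
have c0123 : coprimep F0 (F1 * (F2 * F3)) by rewrite !coprimepMr c01 c02 c03.
have [d0123 e0123] := size_mul_coprime_dvdp _ _ _ _ f0 c0123 d0 d123.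
have szf := leq_trans (dvdp_leq f0 d0123) sf; rewrite -n0' in szf.
have e1 : (2 ^ t.+1 = 2 * 2 ^ t)%N by rewrite expnS.
have e2 : (2 ^ t.+2 = 4 * 2 ^ t)%N by rewrite !expnS mulnA.
rewrite e1 in s2 t2; rewrite e2 in s3 t3.
have no3 := no_three_coprime_roots _ _ _ c12 c13 c23.
move: s0 s1 t1 s2 t2 s3 t3 e23 e123 e0123 szf no3; clear.
move: (size F0) (size F1) (size F2) (size F3) (size (F2 * F3)).
move: (size (F1 * (F2 * F3))) (size (F0 * (F1 * (F2 * F3)))) (2 ^ t)%N.
move=> a123 a0123 s a0 a1 a2 a3 a23 s0 s1 t1 s2 t2 s3 t3 e23 e123 e0123 szf; apply.
- by case: t1 => // t1; lia.
- by case: t2 => // t2; lia.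
- by case: t3 => // t3; lia.
Qed.
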